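(* Let $\lambda\in\mathbb{R}$ with $|\lambda|\le 1$ and $\lambda\neq\pm1$, and let $\mathfrak{r}_{3,\lambda}$ be the real Lie algebra with basis $\{x,y,h\}$ and brackets $[h,x]=x$, $[h,y]=\lambda y$, $[x,y]=0$. A set of representatives of all isomorphism classes of Lie bialgebras on $\mathfrak{r}_{3,\lambda}$ is given by the following cobrackets (matrices with respect to the bases $\{x,y,h\}$ and $\{x\wedge y,\,y\wedge h,\,h\wedge x\}$): $$\begin{pmatrix}0&0&1\\0&0&0\\0&0&0\end{pmatrix};\quad \begin{pmatrix}1&0&0\\0&0&\lambda\\0&0&0\end{pmatrix};\quad \begin{pmatrix}0&\lambda&0\\0&0&0\\0&0&1\end{pmatrix};\quad \begin{pmatrix}0&0&0\\0&\lambda a_3&0\\ a_3&0&0\end{pmatrix},\ a_3\in\mathbb{R}.$$ That is, each of these is a Lie bialgebra cobracket on $\mathfrak{r}_{3,\lambda}$, and every real Lie bialgebra with underlying Lie algebra $\mathfrak{r}_{3,\lambda}$ is isomorphic to exactly one of them.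
   Context: A Lie bialgebra over a field $\mathbb{K}$ is a triple $(\mathfrak{g},[-,-],\delta)$ where $(\mathfrak{g},[-,-])$ is a Lie algebra over $\mathbb{K}$ and $\delta:\mathfrak{g}\to\Lambda^2\mathfrak{g}$ is a linear map (the cobracket) such that the induced map $\delta^*:\Lambda^2\mathfrak{g}^*\to\mathfrak{g}^*$ is a Lie algebra structure on $\mathfrak{g}^*$ (co-Jacobi condition) and $\delta$ is a 1-cocycle, i.e. $\delta[s,t]=[\delta s,t]+[s,\delta t]$ for all $s,t\in\mathfrak g$, with $\mathfrak{g}$ acting on $\Lambda^2\mathfrak{g}$ by the adjoint action ($[s,p\wedge q]=[s,p]\wedge q+p\wedge[s,q]$ and $[p\wedge q,s]=-[s,p\wedge q]$). An isomorphism of Lie bialgebras is a Lie algebra isomorphism $\phi$ with $\delta'\phi=(\phi\wedge\phi)\delta$. Matrix convention: the columns of the matrix of $\delta$ are the coordinates of $\delta(x),\delta(y),\delta(h)$ (in this order) in the ordered basis $\{x\wedge y,\,y\wedge h,\,h\wedge x\}$ of $\Lambda^2\mathfrak{g}$. *)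

(* Defs.v *)
From HB Require Import structures.
From mathcomp Require Import all_boot all_order all_algebra.
From mathcomp Require Import reals ring.

Set Implicit Arguments.
Unset Strict Implicit.
Unset Printing Implicit Defensive.

Import GRing.Theory Num.Theory.
Local Open Scope ring_scope.

(* A finite-dimensional vector space g is 'rV[K]_n and its dual g^* is
   'cV[K]_n, with pairing v *m f.  The tensor square of g is 'M[K]_n, where
   p (x) q is p^T *m q, and Lambda^2 g is the subspace of 'M[K]_n spanned by
   the p /\ q = p (x) q - q (x) p. *)

Section LieBialgebra.
Variable K : fieldType.

Definition is_lie_bracket (V : lmodType K) (br : V -> V -> V) : Prop :=
  [/\ forall u, linear (br u),
      forall v, linear (br^~ v),
      forall u, br u u = 0
    & forall u v w, br (br u v) w + br (br v w) u + br (br w u) v = 0].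

Definition wedge n (p q : 'rV[K]_n) : 'M[K]_n := p^T *m q - q^T *m p.

Definition ext2 n : {vspace 'M[K]_n} :=
  (\sum_(i < n) \sum_(j < n) <[(wedge (delta_mx 0 i) (delta_mx 0 j))%R]>)%VS.

(* The action ad_s (x) 1 + 1 (x) ad_s on g (x) g; see [ad2_wedge]. *)
Definition ad2 n (br : 'rV[K]_n -> 'rV[K]_n -> 'rV[K]_n) (s : 'rV[K]_n)
    (M : 'M[K]_n) : 'M[K]_n :=
  (lin1_mx (br s))^T *m M + M *m lin1_mx (br s).

(* (f, g) |-> delta^*(f /\ g), for the pairing
   <f /\ g, p /\ q> = f(p) g(q) - f(q) g(p); see [dual_bracketE]
   and [wedge_pairing]. *)
Definition dual_bracket n (delta : 'rV[K]_n -> 'M[K]_n) (f g : 'cV[K]_n) :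
    'cV[K]_n :=
  \col_i (f^T *m delta (delta_mx 0 i) *m g) 0 0.

Definition is_lie_bialgebra n (br : 'rV[K]_n -> 'rV[K]_n -> 'rV[K]_n)
    (delta : 'rV[K]_n -> 'M[K]_n) : Prop :=
  [/\ is_lie_bracket br,
      linear delta,
      forall v, delta v \in ext2 n,
      is_lie_bracket (dual_bracket delta)
    & forall s t, delta (br s t) = - ad2 br t (delta s) + ad2 br s (delta t)].

Definition is_lie_iso n m (br : 'rV[K]_n -> 'rV[K]_n -> 'rV[K]_n)
    (br' : 'rV[K]_m -> 'rV[K]_m -> 'rV[K]_m) (phi : 'rV[K]_n -> 'rV[K]_m) :
    Prop :=
  [/\ linear phi, bijective phi
    & forall u v, phi (br u v) = br' (phi u) (phi v)].

(* phi (x) phi, whose restriction to Lambda^2 is phi /\ phi; see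
   [tensor2_wedge]. *)
Definition tensor2 n m (phi : 'rV[K]_n -> 'rV[K]_m) (M : 'M[K]_n) : 'M[K]_m :=
  (lin1_mx phi)^T *m M *m lin1_mx phi.

Definition lie_bialgebra_isomorphic n m
    (br : 'rV[K]_n -> 'rV[K]_n -> 'rV[K]_n) (delta : 'rV[K]_n -> 'M[K]_n)
    (br' : 'rV[K]_m -> 'rV[K]_m -> 'rV[K]_m)
    (delta' : 'rV[K]_m -> 'M[K]_m) : Prop :=
  exists phi : 'rV[K]_n -> 'rV[K]_m,
    is_lie_iso br br' phi /\
    forall v, delta' (phi v) = tensor2 phi (delta v).

Lemma lin1_mxE n m (f : 'rV[K]_n -> 'rV[K]_m) (u : 'rV[K]_n) :
  linear f -> u *m lin1_mx f = f u.
Proof.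
move=> lf; pose fL : {linear 'rV[K]_n -> 'rV[K]_m} := HB.pack f
  (GRing.isLinear.Build K _ _ _ f lf).
exact: (mul_rV_lin1 fL).
Qed.

Lemma ad2_wedge n (br : 'rV[K]_n -> 'rV[K]_n -> 'rV[K]_n) s p q :
  is_lie_bracket br ->
  ad2 br s (wedge p q) = wedge (br s p) q + wedge p (br s q).
Proof.
case=> lbr _ _ _; rewrite /ad2 /wedge mulmxBr mulmxBl !mulmxA -!trmx_mul.
rewrite -!mulmxA !lin1_mxE // addrACA.
by rewrite [X in _ + X = _]addrC addrACA.
Qed.

Lemma tensor2_wedge n m (phi : 'rV[K]_n -> 'rV[K]_m) p q :
  linear phi -> tensor2 phi (wedge p q) = wedge (phi p) (phi q).
Proof.
move=> lphi; rewrite /tensor2 /wedge mulmxBr mulmxBl !mulmxA -!trmx_mul.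
by rewrite -!mulmxA !lin1_mxE.
Qed.

Lemma dual_bracketE n (delta : 'rV[K]_n -> 'M[K]_n) f g v :
  linear delta -> v *m dual_bracket delta f g = f^T *m delta v *m g.
Proof.
move=> ld; pose dL : {linear 'rV[K]_n -> 'M[K]_n} := HB.pack delta
  (GRing.isLinear.Build K _ _ _ delta ld).
have -> : delta v = \sum_i v 0 i *: delta (delta_mx 0 i).
  rewrite {1}[v]row_sum_delta -[delta]/(dL : _ -> _) linear_sum.
  by apply: eq_bigr => i _; rewrite linearZ.
rewrite mulmx_sumr mulmx_suml [LHS]mx11_scalar [RHS]mx11_scalar.
congr _%:M; rewrite !mxE summxE; apply: eq_bigr => i _.
by rewrite -scalemxAr -scalemxAl !mxE; congr (_ * _); rewrite !mxE.
Qed.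

Lemma wedge_pairing n (f g : 'cV[K]_n) p q :
  (f^T *m wedge p q *m g) 0 0 =
  (p *m f) 0 0 * (q *m g) 0 0 - (q *m f) 0 0 * (p *m g) 0 0.
Proof.
rewrite /wedge mulmxBr mulmxBl !mulmxA -!trmx_mul -!mulmxA.
by rewrite mxE [in X in _ + X]mxE ![(_^T *m _) 0 0]mxE !big_ord1 ![_^T _ _]mxE.
Qed.

Lemma wedge_delta n (i j a b : 'I_n) :
  wedge (delta_mx 0 i) (delta_mx 0 j) a b =
  ((a == i) && (b == j))%:R - ((a == j) && (b == i))%:R :> K.
Proof. by rewrite /wedge !trmx_delta !mul_delta_mx !mxE. Qed.

Lemma ext2P n (M : 'M[K]_n) :
  M \in ext2 n <-> M^T = - M /\ forall i, M i i = 0.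
Proof.
split.
  case/memv_sumP=> F hF ->.
  have {}hF i : (F i)^T = - F i /\ forall k, F i k k = 0.
    have /memv_sumP[G hG ->] := hF i isT.
    have {}hG j : (G j)^T = - G j /\ forall k, G j k k = 0.
      have /vlineP[c ->] := hG j isT; split.
        apply/matrixP=> a b; rewrite [LHS]mxE [LHS]mxE [RHS]mxE [in RHS]mxE.
        by rewrite !wedge_delta -mulrN opprB andbC [(b == j) && _]andbC.
      by move=> k; rewrite mxE wedge_delta andbC subrr mulr0.
    split=> [|k].
      by rewrite linear_sum -sumrN; apply: eq_bigr => j _; case: (hG j).
    by rewrite summxE big1 // => j _; case: (hG j) => _ ->.
  split=> [|k].
    by rewrite linear_sum -sumrN; apply: eq_bigr => j _; case: (hF j).
  by rewrite summxE big1 // => j _; case: (hF j) => _ ->.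
case=> tM dM.
have -> : M = \sum_(i < n) \sum_(j < n)
    (if (i < j)%N then M i j else 0) *: wedge (delta_mx 0 i) (delta_mx 0 j).
  have skew a b : M b a = - M a b.
    by have := congr1 (fun N : 'M_n => N a b) tM; rewrite !mxE.
  apply/matrixP=> a b; rewrite summxE.
  under eq_bigr => i _ do rewrite summxE.
  under eq_bigr => i _ do under eq_bigr => j _ do
    rewrite mxE wedge_delta mulrBr.
  under eq_bigr => i _ do rewrite sumrB.
  rewrite sumrB (bigD1 a) //= (bigD1 b) //= !eqxx /= mulr1.
  rewrite big1 => [|j /negPf nj]; last by rewrite eq_sym nj mulr0.
  rewrite big1 => [|i /negPf ni]; last first.
    by apply: big1 => j _; rewrite eq_sym ni mulr0.
  rewrite (bigD1 b) //= (bigD1 a) //= !eqxx /= mulr1.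
  rewrite big1 => [|j /negPf nj]; last by rewrite eq_sym nj mulr0.
  rewrite big1 => [|i /negPf ni]; last first.
    by apply: big1 => j _; rewrite [b == i]eq_sym ni andbF mulr0.
  rewrite !addr0; case: ltngtP => [ab|ba|/val_inj ->].
  - by rewrite subr0.
  - by rewrite sub0r skew.
  - by rewrite subr0 dM.
apply: memv_sumr => i _; apply: memv_sumr => j _.
exact/memvZ/memv_line.
Qed.

End LieBialgebra.

Section R3.
Variable R : realType.

(* The ordered basis {x, y, h} is the standard basis of R^3. *)
Definition r3x : 'rV[R]_3 := delta_mx 0 0.
Definition r3y : 'rV[R]_3 := delta_mx 0 1.
Definition r3h : 'rV[R]_3 := delta_mx 0 2.

(* The bilinear alternating map with the values of [r3_bracket_basis]. *)
Definition r3_bracket (lambda : R) (u v : 'rV[R]_3) : 'rV[R]_3 :=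
  (u 0 2 * v 0 0 - u 0 0 * v 0 2) *: r3x +
  (lambda * (u 0 2 * v 0 1 - u 0 1 * v 0 2)) *: r3y.

Definition wedge_basis (i : 'I_3) : 'M[R]_3 :=
  nth 0 [:: wedge r3x r3y; wedge r3y r3h; wedge r3h r3x] i.

(* The linear map R^3 -> Lambda^2 R^3 with matrix D, acting on columns. *)
Definition cobracket_of_mx (D : 'M[R]_3) (v : 'rV[R]_3) : 'M[R]_3 :=
  \sum_(i < 3) (D *m v^T) i 0 *: wedge_basis i.

Definition mx3 (rows : seq (seq R)) : 'M[R]_3 :=
  \matrix_(i, j) nth 0 (nth [::] rows i) j.

Definition r3_D1 : 'M[R]_3 :=
  mx3 [:: [:: 0; 0; 1];
          [:: 0; 0; 0];
          [:: 0; 0; 0]].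

Definition r3_D2 (lambda : R) : 'M[R]_3 :=
  mx3 [:: [:: 1; 0; 0];
          [:: 0; 0; lambda];
          [:: 0; 0; 0]].

Definition r3_D3 (lambda : R) : 'M[R]_3 :=
  mx3 [:: [:: 0; lambda; 0];
          [:: 0; 0; 0];
          [:: 0; 0; 1]].

Definition r3_D4 (lambda a3 : R) : 'M[R]_3 :=
  mx3 [:: [:: 0; 0; 0];
          [:: 0; lambda * a3; 0];
          [:: a3; 0; 0]].

Definition r3_representative (lambda : R) (D : 'M[R]_3) : Prop :=
  [\/ D = r3_D1, D = r3_D2 lambda, D = r3_D3 lambda
   | exists a3 : R, D = r3_D4 lambda a3].

Lemma r3_bracket_basis lambda :
  [/\ r3_bracket lambda r3h r3x = r3x,
      r3_bracket lambda r3h r3y = lambda *: r3y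
    & r3_bracket lambda r3x r3y = 0].
Proof.
split; rewrite /r3_bracket /r3x /r3y /r3h !mxE /=;
  rewrite ?(mulr0, mul0r, mulr1, subr0, oppr0, scale0r, scale1r, addr0, add0r);
  by [].
Qed.

Lemma r3_bracket_lie lambda : is_lie_bracket (r3_bracket lambda).
Proof.
split=> [u a v w|v a u w|u|u v w];
  apply/rowP=> i; rewrite /r3_bracket !mxE /=; ring.
Qed.

Lemma cobracket_of_mx_basis D (j : 'I_3) :
  cobracket_of_mx D (delta_mx 0 j) = \sum_(i < 3) D i j *: wedge_basis i.
Proof.
by apply: eq_bigr => i _; rewrite trmx_delta -colE mxE.
Qed.

End R3.

(* Main.v *)
(* Write a cobracket as a matrix (a_i | b_i | c_i), i = 1, 2, 3.  Since
   lambda <> 1, the cocycle condition leaves the free parameters a1, a3, c1, c3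
   (with b1 = lambda c3, b2 = lambda a3, c2 = lambda a1, the rest 0), and
   co-Jacobi becomes a3 c1 = (1 + lambda) a1 c3.  Since lambda^2 <> 1, the
   automorphisms of r_{3,lambda} are x |-> p x, y |-> q y, h |-> r x + s y + h
   with p, q <> 0, and they act on the parameters by
     a3 |-> a3,  a1 |-> q a1 - s a3,  c3 |-> p c3 - r a3,
     c1 |-> p q c1 - (1 + lambda) (q r a1 + p s c3 - r s a3).
   So a3 is an invariant; if a3 <> 0, then a1, c3 and hence c1 can be killed.
   If a3 = 0, at most one of a1, c3 is nonzero: a nonzero one is scaled to 1
   and c1 is killed (as 1 + lambda <> 0); if both vanish, c1 is scaled. *)

From HB Require Import structures.
Require Import Defs.
From mathcomp Require Import all_boot all_order all_algebra.
From mathcomp Require Import boolp reals ring lra.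
Import GRing.Theory Num.Theory.
Local Open Scope ring_scope.

Set Implicit Arguments.

Lemma sum_I3 (V : nmodType) (F : 'I_3 -> V) :
  \sum_(i < 3) F i = F 0 + F 1 + F 2.
Proof.
rewrite !big_ord_recl big_ord0 addr0 addrA.
by congr (F _ + F _ + F _); apply: val_inj.
Qed.

Lemma forall_I3 (P : 'I_3 -> Prop) : P 0 -> P 1 -> P 2 -> forall i, P i.
Proof.
move=> P0 P1 P2 [[|[|[|//]]] lti].
- by rewrite (_ : Ordinal lti = 0) //; apply: val_inj.
- by rewrite (_ : Ordinal lti = 1) //; apply: val_inj.
- by rewrite (_ : Ordinal lti = 2) //; apply: val_inj.
Qed.

Section R3Lambda.
Variable R : realType.
Implicit Types (lambda : R) (u v : 'rV[R]_3) (D : 'M[R]_3).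

(** * Explicit coordinates for vectors, covectors and 3 by 3 matrices *)

Definition row3 (a b c : R) : 'rV[R]_3 := \row_j [:: a; b; c]`_j.

Definition col3 (a b c : R) : 'cV[R]_3 := \col_i [:: a; b; c]`_i.

(** Eliminating with this principle, and with its analogues for [col3] and [mx3], replaces an
    arbitrary array by named entries, so that identities reduce to [ring] entry by entry. *)
Lemma row3_ind (P : 'rV[R]_3 -> Prop) :
  (forall a b c, P (row3 a b c)) -> forall u, P u.
Proof.
move=> Prow u; rewrite (_ : u = row3 (u 0 0) (u 0 1) (u 0 2)) //.
by apply/rowP; apply: forall_I3; rewrite !mxE.
Qed.

Lemma col3_ind (P : 'cV[R]_3 -> Prop) :
  (forall a b c, P (col3 a b c)) -> forall f, P f.
Proof.
move=> Pcol f; rewrite (_ : f = col3 (f 0 0) (f 1 0) (f 2 0)) //.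
by apply/colP; apply: forall_I3; rewrite !mxE.
Qed.

Lemma mx3_ind (P : 'M[R]_3 -> Prop) :
  (forall a b c d e f g h i,
     P (mx3 [:: [:: a; b; c]; [:: d; e; f]; [:: g; h; i]])) ->
  forall A, P A.
Proof.
move=> Pmx A; rewrite (_ : A = mx3 [:: [:: A 0 0; A 0 1; A 0 2];
  [:: A 1 0; A 1 1; A 1 2]; [:: A 2 0; A 2 1; A 2 2]]) //.
by apply/matrixP; apply: forall_I3; apply: forall_I3; rewrite !mxE.
Qed.

Lemma delta_row3 : [/\ delta_mx 0 0 = row3 1 0 0, delta_mx 0 1 = row3 0 1 0
  & delta_mx 0 2 = row3 0 0 1].
Proof. by split; apply/rowP; apply: forall_I3; rewrite !mxE. Qed.

Lemma row3_add (a b c a' b' c' : R) :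
  row3 a b c + row3 a' b' c' = row3 (a + a') (b + b') (c + c').
Proof. by apply/rowP; apply: forall_I3; rewrite !mxE. Qed.

Lemma row3_scale (k a b c : R) :
  k *: row3 a b c = row3 (k * a) (k * b) (k * c).
Proof. by apply/rowP; apply: forall_I3; rewrite !mxE. Qed.

Lemma row3_mul (u0 u1 u2 a b c d e f g h i : R) :
  row3 u0 u1 u2 *m mx3 [:: [:: a; b; c]; [:: d; e; f]; [:: g; h; i]] =
  row3 (u0 * a + u1 * d + u2 * g) (u0 * b + u1 * e + u2 * h)
       (u0 * c + u1 * f + u2 * i).
Proof. by apply/rowP; apply: forall_I3; rewrite !mxE sum_I3 !mxE. Qed.

Lemma mx3_mul (a b c d e f g h i a' b' c' d' e' f' g' h' i' : R) :
  mx3 [:: [:: a; b; c]; [:: d; e; f]; [:: g; h; i]] *m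
  mx3 [:: [:: a'; b'; c']; [:: d'; e'; f']; [:: g'; h'; i']] =
  mx3 [:: [:: a * a' + b * d' + c * g'; a * b' + b * e' + c * h';
              a * c' + b * f' + c * i'];
          [:: d * a' + e * d' + f * g'; d * b' + e * e' + f * h';
              d * c' + e * f' + f * i'];
          [:: g * a' + h * d' + i * g'; g * b' + h * e' + i * h';
              g * c' + h * f' + i * i']].
Proof.
by apply/matrixP; apply: forall_I3; apply: forall_I3; rewrite !mxE sum_I3 !mxE.
Qed.

Lemma mx3_opp (a b c d e f g h i : R) :
  - mx3 [:: [:: a; b; c]; [:: d; e; f]; [:: g; h; i]] =
  mx3 [:: [:: - a; - b; - c]; [:: - d; - e; - f]; [:: - g; - h; - i]].
Proof.
by apply/matrixP; apply: forall_I3; apply: forall_I3; rewrite !mxE.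
Qed.

Lemma mx3_tr (a b c d e f g h i : R) :
  (mx3 [:: [:: a; b; c]; [:: d; e; f]; [:: g; h; i]])^T =
  mx3 [:: [:: a; d; g]; [:: b; e; h]; [:: c; f; i]].
Proof.
by apply/matrixP; apply: forall_I3; apply: forall_I3; rewrite !mxE.
Qed.

Lemma mx3_inj (a b c d e f g h i a' b' c' d' e' f' g' h' i' : R) :
  mx3 [:: [:: a; b; c]; [:: d; e; f]; [:: g; h; i]] =
  mx3 [:: [:: a'; b'; c']; [:: d'; e'; f']; [:: g'; h'; i']] ->
  [/\ a = a', b = b' & c = c'] /\
  [/\ d = d', e = e' & f = f'] /\ [/\ g = g', h = h' & i = i'].
Proof.
move=> /matrixP E.
have := (E 0 0, E 0 1, E 0 2, (E 1 0, E 1 1, E 1 2), (E 2 0, E 2 1, E 2 2)).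
by rewrite !mxE /= => -[[[[-> ->] ->] [[-> ->] ->]] [[-> ->] ->]].
Qed.

Lemma row3_inj (a b c a' b' c' : R) :
  row3 a b c = row3 a' b' c' -> [/\ a = a', b = b' & c = c'].
Proof.
by move=> /rowP E; have := (E 0, E 1, E 2); rewrite !mxE /= => -[[-> ->] ->].
Qed.

(** The bivector with coordinates a, b, c in the basis x/\y, y/\h, h/\x. The third basis vector is
    h/\x and not x/\h, hence the sign of c in the top right corner. *)
Definition skew3 (a b c : R) : 'M[R]_3 :=
  mx3 [:: [:: 0; a; - c]; [:: - a; 0; b]; [:: c; - b; 0]].

Lemma skew3_add (a b c a' b' c' : R) :
  skew3 a b c + skew3 a' b' c' = skew3 (a + a') (b + b') (c + c').
Proof.
by apply/matrixP; apply: forall_I3; apply: forall_I3;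
  rewrite !mxE /= ?addr0 ?opprD.
Qed.

Lemma skew3_scale (k a b c : R) :
  k *: skew3 a b c = skew3 (k * a) (k * b) (k * c).
Proof.
by apply/matrixP; apply: forall_I3; apply: forall_I3;
  rewrite !mxE /= ?mulr0 ?mulrN.
Qed.

Lemma skew3_inj (a b c a' b' c' : R) :
  skew3 a b c = skew3 a' b' c' -> [/\ a = a', b = b' & c = c'].
Proof.
move=> /matrixP E; have := (E 0 1, E 1 2, E 2 0).
by rewrite !mxE /= => -[[-> ->] ->].
Qed.

(** * The cobracket, the bracket and the actions they induce, in coordinates *)

Lemma cobracket_of_mxE (a b c d e f g h i v0 v1 v2 : R) :
  cobracket_of_mx (mx3 [:: [:: a; b; c]; [:: d; e; f]; [:: g; h; i]])
    (row3 v0 v1 v2) =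
  skew3 (a * v0 + b * v1 + c * v2) (d * v0 + e * v1 + f * v2)
        (g * v0 + h * v1 + i * v2).
Proof.
rewrite /cobracket_of_mx sum_I3 /wedge_basis /wedge /=.
rewrite (_ : _ *m _ = col3 (a * v0 + b * v1 + c * v2)
  (d * v0 + e * v1 + f * v2) (g * v0 + h * v1 + i * v2)); last first.
  by apply/colP; apply: forall_I3; rewrite !mxE sum_I3 !mxE.
move: (a * v0 + _ + _) (d * v0 + _ + _) (g * v0 + _ + _) => xy yh hx.
apply/matrixP; apply: forall_I3; apply: forall_I3;
  by rewrite !mxE !big_ord1 !mxE /=; ring.
Qed.

Lemma r3_bracketE lambda (a b c a' b' c' : R) :
  r3_bracket lambda (row3 a b c) (row3 a' b' c') =
  row3 (c * a' - a * c') (lambda * (c * b' - b * c')) 0.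
Proof.
by rewrite /r3_bracket; apply/rowP; apply: forall_I3; rewrite !mxE /=; ring.
Qed.

Lemma lin1_mx_r3_bracket lambda (a b c : R) :
  lin1_mx (r3_bracket lambda (row3 a b c)) =
  mx3 [:: [:: c; 0; 0]; [:: 0; lambda * c; 0]; [:: - a; - (lambda * b); 0]].
Proof.
have [e0 e1 e2] := delta_row3.
apply/matrixP; apply: forall_I3; apply: forall_I3;
  by rewrite mxE ?(e0, e1, e2) r3_bracketE !mxE /=; ring.
Qed.

(** The basis bivectors x/\y, y/\h, h/\x are eigenvectors of h with eigenvalues 1 + [lambda],
    [lambda], 1, while x sends y/\h to x/\y and y sends h/\x to [lambda] times x/\y. *)
Lemma ad2_r3_bracket lambda (a b c p q r : R) :
  ad2 (r3_bracket lambda) (row3 a b c) (skew3 p q r) =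
  skew3 (c * (1 + lambda) * p + a * q + b * lambda * r)
        (c * lambda * q) (c * r).
Proof.
rewrite /ad2 lin1_mx_r3_bracket mx3_tr !mx3_mul.
apply/matrixP; apply: forall_I3; apply: forall_I3;
  by rewrite !mxE /=; ring.
Qed.

Lemma cobracket_of_mx_linear D : linear (cobracket_of_mx D).
Proof.
move=> k; elim/mx3_ind: D => ? ? ? ? ? ? ? ? ?; elim/row3_ind => ? ? ?; elim/row3_ind => ? ? ?.
rewrite row3_scale row3_add !cobracket_of_mxE skew3_scale skew3_add.
by congr skew3; ring.
Qed.

Lemma skew3_ext2 (a b c : R) : skew3 a b c \in ext2 R 3.
Proof.
apply/ext2P; rewrite /skew3 mx3_tr mx3_opp !opprK !oppr0; split=> //.
by apply: forall_I3; rewrite mxE.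
Qed.

Lemma cobracket_of_mx_exists (delta : 'rV[R]_3 -> 'M[R]_3) :
  linear delta -> (forall v, delta v \in ext2 R 3) ->
  exists D, delta = cobracket_of_mx D.
Proof.
move=> ldelta adelta.
have skewE v : exists a b c, delta v = skew3 a b c.
  have := adelta v; elim/mx3_ind: (delta v) => a b c d e f g h i.
  move=> /ext2P[]; rewrite mx3_tr mx3_opp => /mx3_inj.
  (* The coordinate on h/\x is the opposite of the top right entry c. *)
  move=> [[_ -> ->] [[_ _ ->] _]] dg; exists b, f, (- c).
  by have := (dg 0, dg 1, dg 2); rewrite /skew3 !mxE /= opprK => -[[-> ->] ->].
have [[a [d [g e0]]] [b [e [h e1]]] [c [f [i e2]]]] :=
  And3 (skewE (row3 1 0 0)) (skewE (row3 0 1 0)) (skewE (row3 0 0 1)).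
exists (mx3 [:: [:: a; b; c]; [:: d; e; f]; [:: g; h; i]]).
apply/funext; elim/row3_ind => u v w.
pose deltaL : {linear 'rV[R]_3 -> 'M[R]_3} := HB.pack delta
  (GRing.isLinear.Build R _ _ _ delta ldelta).
rewrite (_ : row3 u v w = u *: row3 1 0 0 + v *: row3 0 1 0 + w *: row3 0 0 1);
  last by rewrite !row3_scale !row3_add; congr row3; ring.
rewrite -[delta]/(deltaL : _ -> _) !linearD !linearZ /= e0 e1 e2.
rewrite !row3_scale !row3_add cobracket_of_mxE !skew3_scale !skew3_add.
by congr skew3; ring.
Qed.

(** The dual bracket is the transposed matrix applied to the 2 by 2 minors of the pair of covectors,
    which are the coordinates of their wedge. *)
Lemma dual_bracketE_mx3 (a b c d e f g h i f0 f1 f2 g0 g1 g2 : R) :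
  dual_bracket
    (cobracket_of_mx (mx3 [:: [:: a; b; c]; [:: d; e; f]; [:: g; h; i]]))
    (col3 f0 f1 f2) (col3 g0 g1 g2) =
  col3
    (a * (f0 * g1 - f1 * g0) + d * (f1 * g2 - f2 * g1) + g * (f2 * g0 - f0 * g2))
    (b * (f0 * g1 - f1 * g0) + e * (f1 * g2 - f2 * g1) + h * (f2 * g0 - f0 * g2))
    (c * (f0 * g1 - f1 * g0) + f * (f1 * g2 - f2 * g1) + i * (f2 * g0 - f0 * g2)).
Proof.
have [e0 e1 e2] := delta_row3.
have trE (a' b' c' : R) : (col3 a' b' c')^T = row3 a' b' c'.
  by apply/rowP => j; rewrite !mxE.
apply/colP; apply: forall_I3;
  by rewrite mxE ?(e0, e1, e2) trE cobracket_of_mxE /skew3 row3_mul mxE sum_I3 !mxE /=;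
     ring.
Qed.

Lemma col3_add (a b c a' b' c' : R) :
  col3 a b c + col3 a' b' c' = col3 (a + a') (b + b') (c + c').
Proof. by apply/colP; apply: forall_I3; rewrite !mxE. Qed.

Lemma col3_scale (k a b c : R) :
  k *: col3 a b c = col3 (k * a) (k * b) (k * c).
Proof. by apply/colP; apply: forall_I3; rewrite !mxE. Qed.

Lemma col3_0 : 0 = col3 0 0 0.
Proof. by apply/colP; apply: forall_I3; rewrite !mxE. Qed.

(** * Cocycles on the algebra and the co-Jacobi condition *)

Definition r3_cocycle_mx lambda (a1 a3 c1 c3 : R) : 'M[R]_3 :=
  mx3 [:: [:: a1; lambda * c3; c1];
          [:: 0; lambda * a3; lambda * a1];
          [:: a3; 0; c3]].

Lemma r3_cocycle_mx_lie_bialgebra lambda a1 a3 c1 c3 :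
  a3 * c1 = (1 + lambda) * a1 * c3 ->
  is_lie_bialgebra (r3_bracket lambda)
    (cobracket_of_mx (r3_cocycle_mx lambda a1 a3 c1 c3)).
Proof.
move=> coJacobi; split.
- exact: r3_bracket_lie.
- exact: cobracket_of_mx_linear.
- by move=> v; elim/row3_ind: v => *; rewrite cobracket_of_mxE; apply: skew3_ext2.
- split.
  + elim/col3_ind => ? ? ? k; elim/col3_ind => ? ? ?; elim/col3_ind => ? ? ?.
    rewrite col3_scale col3_add !dual_bracketE_mx3 col3_scale col3_add.
    by congr col3; ring.
  + elim/col3_ind => ? ? ? k; elim/col3_ind => ? ? ?; elim/col3_ind => ? ? ?.
    rewrite col3_scale col3_add !dual_bracketE_mx3 col3_scale col3_add.
    by congr col3; ring.
  + by elim/col3_ind => ? ? ?; rewrite dual_bracketE_mx3 col3_0; congr col3; ring.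
  + elim/col3_ind => ? ? ?; elim/col3_ind => ? ? ?; elim/col3_ind => ? ? ?.
    rewrite !dual_bracketE_mx3 !col3_add col3_0.
    (* The Jacobi sum is the determinant of the three covectors times a fixed covector, whose only
       nonzero coordinate is (1 - [lambda]) (a3 c1 - (1 + [lambda]) a1 c3). *)
    by congr col3; ring: coJacobi.
- elim/row3_ind => ? ? ?; elim/row3_ind => ? ? ?.
  rewrite r3_bracketE !cobracket_of_mxE !ad2_r3_bracket -scaleN1r.
  rewrite skew3_scale skew3_add.
  by congr skew3; ring.
Qed.

Lemma col3_inj (a b c a' b' c' : R) :
  col3 a b c = col3 a' b' c' -> [/\ a = a', b = b' & c = c'].
Proof.
by move=> /colP E; have := (E 0, E 1, E 2); rewrite !mxE /= => -[[-> ->] ->].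
Qed.

Lemma lie_bialgebra_r3_cocycle_mx lambda (delta : 'rV[R]_3 -> 'M[R]_3) :
    lambda != 1 -> is_lie_bialgebra (r3_bracket lambda) delta ->
  exists a1 a3 c1 c3, a3 * c1 = (1 + lambda) * a1 * c3 /\
    delta = cobracket_of_mx (r3_cocycle_mx lambda a1 a3 c1 c3).
Proof.
rewrite -subr_eq0 => lambda1 [_ ldelta adelta [_ _ _ coJacobi] cocycle].
have [D eD] := cobracket_of_mx_exists ldelta adelta.
rewrite {ldelta adelta delta}eD in coJacobi cocycle *.
elim/mx3_ind: D coJacobi cocycle => a1 b1 c1 a2 b2 c2 a3 b3 c3 coJacobi cocycle.
(* The pair (h, x) gives c2 = [lambda] a1 and (1 - [lambda]) a2 = 0; the pair (h, y) gives b1 =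
   [lambda] c3 and (1 - [lambda]) b3 = 0; the pair (x, y) gives b2 = [lambda] a3. *)
have := cocycle (row3 0 0 1) (row3 1 0 0).
rewrite r3_bracketE !cobracket_of_mxE !ad2_r3_bracket -scaleN1r.
rewrite skew3_scale skew3_add => /skew3_inj[hx1 hx2 _].
have := cocycle (row3 0 0 1) (row3 0 1 0).
rewrite r3_bracketE !cobracket_of_mxE !ad2_r3_bracket -scaleN1r.
rewrite skew3_scale skew3_add => /skew3_inj[hy1 _ hy3].
have := cocycle (row3 1 0 0) (row3 0 1 0).
rewrite r3_bracketE !cobracket_of_mxE !ad2_r3_bracket -scaleN1r.
rewrite skew3_scale skew3_add => /skew3_inj[xy1 _ _].
have a20 : a2 = 0.
  by apply: (mulfI lambda1); lra.
have b30 : b3 = 0 by apply: (mulfI lambda1); lra.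
have c2E : c2 = lambda * a1 by lra.
have b1E : b1 = lambda * c3 by lra.
have b2E : b2 = lambda * a3 by lra.
move: coJacobi; rewrite a20 b30 c2E b1E b2E => coJacobi.
exists a1, a3, c1, c3; split=> //.
(* On the dual basis only the last coordinate of the Jacobi sum carries information: it is the
   co-Jacobi relation multiplied by 1 - [lambda], which can be cancelled. *)
have := coJacobi (col3 1 0 0) (col3 0 1 0) (col3 0 0 1).
rewrite !dual_bracketE_mx3 !col3_add col3_0 => /col3_inj[_ _ E].
by apply: (mulfI lambda1); lra.
Qed.

(** * Automorphisms of the Lie algebra and their action on bivectors *)

Lemma tensor2_mulmxr n m (M : 'M[R]_(n, m)) (A : 'M[R]_n) :
  tensor2 (mulmxr M) A = M^T *m A *m M.
Proof.
rewrite /tensor2 (_ : lin1_mx _ = M) //.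
by apply/matrixP => i j; rewrite mxE /= -rowE mxE.
Qed.

(** Vectors are rows and maps multiply on the right, so the rows are the images of x, y, h. *)
Definition r3_aut_mx (p q r s : R) : 'M[R]_3 :=
  mx3 [:: [:: p; 0; 0]; [:: 0; q; 0]; [:: r; s; 1]].

Lemma tensor2_r3_aut (p q r s a b c : R) :
  tensor2 (mulmxr (r3_aut_mx p q r s)) (skew3 a b c) =
  skew3 (p * q * a - q * r * b - p * s * c) (q * b) (p * c).
Proof.
rewrite tensor2_mulmxr mx3_tr !mx3_mul.
apply/matrixP; apply: forall_I3; apply: forall_I3;
  by rewrite !mxE /=; ring.
Qed.

Lemma r3_aut_lie_iso lambda (p q r s : R) : p != 0 -> q != 0 ->
  is_lie_iso (r3_bracket lambda) (r3_bracket lambda)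
    (mulmxr (r3_aut_mx p q r s)).
Proof.
move=> p0 q0; split=> [k u v||].
- exact: linearP.
(* The inverse lies in the same family: x and y are scaled back, and h goes to h - (r/p) x - (s/q)
   y. *)
- exists (mulmxr (r3_aut_mx p^-1 q^-1 (- r / p) (- s / q)));
    elim/row3_ind => a b c; rewrite /= !row3_mul; congr row3; field;
    by rewrite ?p0 ?q0.
- elim/row3_ind => ? ? ?; elim/row3_ind => ? ? ?.
  by rewrite /= r3_bracketE !row3_mul r3_bracketE; congr row3; ring.
Qed.

(** The image of h has h-coordinate t, so it acts on the span of x and y with eigenvalues t and t
    [lambda]. These must be 1 and [lambda] again; the exchange t = [lambda], t [lambda] = 1 would
    force [lambda]^2 = 1, so t = 1 and each eigenline is preserved. *)
Lemma r3_lie_isoE lambda (phi : 'rV[R]_3 -> 'rV[R]_3) :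
    lambda != 1 -> lambda != -1 ->
    is_lie_iso (r3_bracket lambda) (r3_bracket lambda) phi ->
  exists p q r s, [/\ p != 0, q != 0 & phi = mulmxr (r3_aut_mx p q r s)].
Proof.
move=> lambda1 lambdaN1 [lphi /bij_inj phi_inj phi_br].
have [M phiE] : exists M, phi = mulmxr M.
  by exists (lin1_mx phi); apply/funext => u; rewrite /= lin1_mxE.
elim/mx3_ind: M phiE => p p1 p2 q0 q q2 r s t phiE.
have phi_x : phi (row3 1 0 0) = row3 p p1 p2.
  by rewrite phiE /= row3_mul; congr row3; ring.
have phi_y : phi (row3 0 1 0) = row3 q0 q q2.
  by rewrite phiE /= row3_mul; congr row3; ring.
have phi_h : phi (row3 0 0 1) = row3 r s t.
  by rewrite phiE /= row3_mul; congr row3; ring.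
have phi_0 : phi (row3 0 0 0) = row3 0 0 0.
  by rewrite phiE /= row3_mul; congr row3; ring.
have x_neq0 : row3 p p1 p2 <> row3 0 0 0.
  rewrite -phi_x -phi_0 => /phi_inj /row3_inj[/eqP].
  by rewrite oner_eq0.
have y_neq0 : row3 q0 q q2 <> row3 0 0 0.
  rewrite -phi_y -phi_0 => /phi_inj /row3_inj[_ /eqP].
  by rewrite oner_eq0.
have [hx0 hx1 p20] : [/\ (t - 1) * p = 0, (lambda * t - 1) * p1 = 0 & p2 = 0].
  have := phi_br (row3 0 0 1) (row3 1 0 0).
  rewrite phi_h phi_x r3_bracketE phiE r3_bracketE /= row3_mul.
  move=> /row3_inj[e0 e1 e2]; have p20 : p2 = 0 by lra.
  by move: e0 e1; rewrite p20 => e0 e1; split=> //; lra.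
move: x_neq0; rewrite p20 => x_neq0.
have xy : p * q2 = 0 /\ lambda * p1 * q2 = 0.
  have := phi_br (row3 1 0 0) (row3 0 1 0).
  rewrite phi_y phi_x r3_bracketE phiE r3_bracketE /= row3_mul p20.
  by move=> /row3_inj[e0 e1 _]; split; lra.
have hy : [/\ t * q0 - r * q2 = lambda * q0,
    lambda * (t * q - s * q2) = lambda * q & lambda * q2 = 0].
  have := phi_br (row3 0 0 1) (row3 0 1 0).
  rewrite phi_y phi_h r3_bracketE phiE r3_bracketE /= row3_mul.
  by move=> /row3_inj[e0 e1 e2]; split; lra.
(* For [lambda] nonzero this is the h-coordinate of the image of [h, y]. For [lambda] = 0 the image
   of x is p x with p nonzero, and [x, y] = 0 gives p q2 = 0. *)
have q20 : q2 = 0.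
  have [l0|l_neq0] := eqVneq lambda 0; last first.
    by apply: (mulfI l_neq0); case: hy => _ _ ->; rewrite mulr0.
  have p10 : p1 = 0 by move: hx1; rewrite l0; lra.
  have [p0|p_neq0] := eqVneq p 0; first by case: x_neq0; rewrite p0 p10.
  by apply: (mulfI p_neq0); case: xy => -> _; rewrite mulr0.
move: hy y_neq0; rewrite q20 !mulr0 !subr0 => -[hy0 hy1 _] y_neq0.
(* If t differs from 1, then p = 0, so p1 is nonzero and [lambda] t = 1; this kills q, so q0 is
   nonzero and t = [lambda], whence [lambda]^2 = 1. *)
have t1 : t = 1.
  apply/eqP/negPn/negP => t1.
  have p0 : p = 0.
    by move/eqP: hx0; rewrite mulf_eq0 subr_eq0 (negPf t1) => /eqP.
  have lt1 : lambda * t = 1.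
    move/eqP: hx1; rewrite mulf_eq0 subr_eq0 => /orP[/eqP //|/eqP p10].
    by case: x_neq0; rewrite p0 p10.
  have q_0 : q = 0.
    have : (t - 1) * q = 0.
      transitivity (t * (lambda * (t * q) - lambda * q)); first by ring: lt1.
      by rewrite hy1 subrr mulr0.
    by move/eqP; rewrite mulf_eq0 subr_eq0 (negPf t1) => /eqP.
  have tl : t = lambda.
    have : (t - lambda) * q0 = 0 by lra.
    move/eqP; rewrite mulf_eq0 subr_eq0 => /orP[/eqP //|/eqP q00].
    by case: y_neq0; rewrite q00 q_0.
  have : (lambda - 1) * (lambda + 1) == 0.
    by apply/eqP; move: lt1; rewrite tl; lra.
  by rewrite mulf_eq0 subr_eq0 addr_eq0 (negPf lambda1) (negPf lambdaN1).
have lambda1' : lambda - 1 != 0 by rewrite subr_eq0.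
move: hx1 hy0 phiE; rewrite t1 p20 q20 => hx1 hy0 phiE.
have p10 : p1 = 0 by apply: (mulfI lambda1'); lra.
have q00 : q0 = 0 by apply: (mulfI lambda1'); lra.
exists p, q, r, s; split.
- by apply/eqP => p0; apply: x_neq0; rewrite p0 p10.
- by apply/eqP => q_0; apply: y_neq0; rewrite q_0 q00.
- by rewrite phiE p10 q00.
Qed.

(** * Isomorphism expressed on the four parameters *)

Lemma r3_isomorphicP lambda (a1 a3 c1 c3 a1' a3' c1' c3' : R) :
    lambda != 1 -> lambda != -1 ->
  lie_bialgebra_isomorphic
    (r3_bracket lambda) (cobracket_of_mx (r3_cocycle_mx lambda a1 a3 c1 c3))
    (r3_bracket lambda) (cobracket_of_mx (r3_cocycle_mx lambda a1' a3' c1' c3'))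
  <-> exists p q r s : R, [/\ p != 0, q != 0 &
  [/\ a3' = a3, a1' = q * a1 - s * a3, c3' = p * c3 - r * a3
    & c1' = p * q * c1
            - (1 + lambda) * (q * r * a1 + p * s * c3 - r * s * a3)]].
Proof.
move=> lambda1 lambdaN1; split=> [[phi [phi_iso]]|].
  have [p [q [r [s [p0 q0 ->]]]]] := r3_lie_isoE lambda1 lambdaN1 phi_iso.
  move=> phi_delta; exists p, q, r, s; split=> //.
  (* The values at x determine a1' and a3'; those at h then determine c3' and c1'. *)
  have := phi_delta (row3 1 0 0).
  rewrite /= row3_mul !cobracket_of_mxE tensor2_r3_aut => /skew3_inj[e1 _ e3].
  have a3E : a3' = a3 by apply: (mulfI p0); lra.
  have a1E : a1' = q * a1 - s * a3 by apply: (mulfI p0); lra.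
  have := phi_delta (row3 0 0 1).
  rewrite /= row3_mul !cobracket_of_mxE tensor2_r3_aut => /skew3_inj[e4 _ e5].
  have c3E : c3' = p * c3 - r * a3 by move: e5; rewrite a3E; lra.
  split=> //; move: e4; rewrite a1E c3E; lra.
move=> [p [q [r [s [p0 q0 [-> -> -> ->]]]]]].
exists (mulmxr (r3_aut_mx p q r s)); split; first exact: r3_aut_lie_iso.
elim/row3_ind => *; rewrite /= row3_mul !cobracket_of_mxE tensor2_r3_aut.
by congr skew3; ring.
Qed.

(** * Normal forms: existence and invariance *)

(** The invariant a3 is tested first. When a3 = 0 and 1 + [lambda] is nonzero, co-Jacobi lets at
    most one of a1, c3 be nonzero, so the order of these two tests is immaterial for bialgebras. The
    zero cobracket is the member a3 = 0 of the fourth family. *)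
Definition r3_normal_form lambda (a1 a3 c1 c3 : R) : 'M[R]_3 :=
  if a3 != 0 then r3_D4 lambda a3
  else if a1 != 0 then r3_D2 lambda
  else if c3 != 0 then r3_D3 lambda
  else if c1 != 0 then r3_D1 R
  else r3_D4 lambda 0.

Lemma r3_D_cocycle_mx lambda :
  [/\ r3_D1 R = r3_cocycle_mx lambda 0 0 1 0,
      r3_D2 lambda = r3_cocycle_mx lambda 1 0 0 0,
      r3_D3 lambda = r3_cocycle_mx lambda 0 0 0 1
    & forall a3, r3_D4 lambda a3 = r3_cocycle_mx lambda 0 a3 0 0].
Proof.
by split; rewrite /r3_cocycle_mx ?mulr0 ?mulr1 // => a; rewrite !mulr0.
Qed.

(** Each representative is its own normal form, so uniqueness reduces to the invariance of normal
    forms. *)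
Lemma r3_representative_normal_form lambda D : r3_representative lambda D ->
  exists a1 a3 c1 c3, [/\ a3 * c1 = (1 + lambda) * a1 * c3,
    D = r3_cocycle_mx lambda a1 a3 c1 c3
    & D = r3_normal_form lambda a1 a3 c1 c3].
Proof.
have [D1 D2 D3 D4] := r3_D_cocycle_mx lambda.
case=> [->|->|->|[a3 ->]]; [rewrite D1; exists 0, 0, 1, 0
  | rewrite D2; exists 1, 0, 0, 0 | rewrite D3; exists 0, 0, 0, 1
  | rewrite D4; exists 0, a3, 0, 0];
  split=> //; try ring; rewrite /r3_normal_form ?eqxx ?oner_eq0 //=.
by case: eqVneq => [->|]; rewrite D4.
Qed.

Lemma r3_normal_form_representative lambda (a1 a3 c1 c3 : R) :
  r3_representative lambda (r3_normal_form lambda a1 a3 c1 c3).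
Proof.
rewrite /r3_normal_form; do 4? [case: ifP => _].
- by apply: Or44; exists a3.
- exact: Or42.
- exact: Or43.
- exact: Or41.
- by apply: Or44; exists 0.
Qed.

Lemma r3_normal_form_isomorphic lambda (a1 a3 c1 c3 : R) :
    lambda != 1 -> lambda != -1 -> a3 * c1 = (1 + lambda) * a1 * c3 ->
  lie_bialgebra_isomorphic
    (r3_bracket lambda) (cobracket_of_mx (r3_cocycle_mx lambda a1 a3 c1 c3))
    (r3_bracket lambda) (cobracket_of_mx (r3_normal_form lambda a1 a3 c1 c3)).
Proof.
move=> lambda1 lambdaN1 coJacobi; have [D1 D2 D3 D4] := r3_D_cocycle_mx lambda.
have lambdaD1 : 1 + lambda != 0 by rewrite addrC addr_eq0.
rewrite /r3_normal_form; case: eqVneq => [a30|a3_neq0] /=; last first.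
  rewrite D4; apply/r3_isomorphicP => //.
  (* With p = q = 1, these r and s solve c3 - r a3 = 0 and a1 - s a3 = 0; then a3 times the new c1
     is a3 c1 - (1 + [lambda]) a1 c3, which vanishes by co-Jacobi. *)
  exists 1, 1, (c3 / a3), (a1 / a3); rewrite oner_eq0; split=> //.
  split=> //; try by field.
  apply: (mulfI a3_neq0).
  transitivity (a3 * c1 - (1 + lambda) * a1 * c3); last by field.
  by rewrite coJacobi; ring.
move: coJacobi; rewrite a30 mul0r => /esym coJacobi.
case: eqVneq => [a10|a1_neq0] /=; last first.
  have c30 : c3 = 0.
    by apply/eqP; move/eqP: coJacobi;
      rewrite !mulf_eq0 (negPf lambdaD1) (negPf a1_neq0).
  rewrite D2; apply/r3_isomorphicP => //.
  (* Here q scales a1 to 1, and r solves c1 / a1 - (1 + [lambda]) r = 0. *)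
  exists 1, a1^-1, (c1 / (a1 * (1 + lambda))), 0.
  rewrite oner_eq0 invr_eq0 c30; split=> //.
  by split=> //; try ring; field; rewrite ?a1_neq0 ?lambdaD1 //.
case: eqVneq => [c30|c3_neq0] /=; last first.
  rewrite D3; apply/r3_isomorphicP => //.
  (* Symmetrically, p scales c3 to 1 and s kills c1. *)
  exists c3^-1, 1, 0, (c1 / (c3 * (1 + lambda))).
  rewrite oner_eq0 invr_eq0 a10; split=> //.
  by split=> //; try ring; field; rewrite ?c3_neq0 ?lambdaD1 //.
case: eqVneq => [c10|c1_neq0] /=.
  rewrite D4; apply/r3_isomorphicP => //; rewrite a10 c30 c10.
  by exists 1, 1, 0, 0; rewrite oner_eq0; split=> //; split; ring.
rewrite D1; apply/r3_isomorphicP => //; rewrite a10 c30.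
exists c1^-1, 1, 0, 0; rewrite oner_eq0 invr_eq0; split=> //.
by split; try ring; field.
Qed.

(** The normal form depends only on a3 and on which parameters vanish. Since a3 is fixed, a1 and c3
    are merely rescaled when a3 = 0, and c1 is rescaled when all three vanish, every test has the
    same outcome on both sides. *)
Lemma r3_normal_form_invariant lambda (a1 a3 c1 c3 a1' a3' c1' c3' : R) :
    lambda != 1 -> lambda != -1 ->
  lie_bialgebra_isomorphic
    (r3_bracket lambda) (cobracket_of_mx (r3_cocycle_mx lambda a1 a3 c1 c3))
    (r3_bracket lambda) (cobracket_of_mx (r3_cocycle_mx lambda a1' a3' c1' c3')) ->
  r3_normal_form lambda a1 a3 c1 c3 = r3_normal_form lambda a1' a3' c1' c3'.
Proof.
move=> lambda1 lambdaN1 iso.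
have [p [q [r [s [/negPf p0 /negPf q0 [-> -> -> ->]]]]]] :=
  (r3_isomorphicP _ _ _ _ _ _ _ _ _ lambda1 lambdaN1).1 iso.
rewrite /r3_normal_form; case: (eqVneq a3 0) => //= ->.
rewrite !mulr0 !subr0 !mulf_eq0 p0 q0 /=.
case: (eqVneq a1 0) => //= ->; case: (eqVneq c3 0) => //= ->.
by rewrite !mulr0 addr0 mulr0 subr0 !mulf_eq0 p0 q0.
Qed.

End R3Lambda.

Unset Implicit Arguments.

Theorem theorem6p3 (R : realType) (lambda : R)
    (hle : `|lambda| <= 1) (hne1 : lambda != 1) (hneN1 : lambda != -1) :
  (forall D : 'M[R]_3, r3_representative lambda D ->
     is_lie_bialgebra (r3_bracket lambda) (cobracket_of_mx D)) /\
  (forall delta : 'rV[R]_3 -> 'M[R]_3,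
     is_lie_bialgebra (r3_bracket lambda) delta ->
     exists! D : 'M[R]_3, r3_representative lambda D /\
       lie_bialgebra_isomorphic (r3_bracket lambda) delta
         (r3_bracket lambda) (cobracket_of_mx D)).
Proof.
split=> [D /r3_representative_normal_form[a1 [a3 [c1 [c3 [E -> _]]]]]|delta].
  exact: r3_cocycle_mx_lie_bialgebra.
move=> /(lie_bialgebra_r3_cocycle_mx hne1)[a1 [a3 [c1 [c3 [coJacobi ->]]]]].
exists (r3_normal_form R lambda a1 a3 c1 c3); split.
  by split; [apply: r3_normal_form_representative
            | apply: r3_normal_form_isomorphic].
(* A competing representative is the normal form of its own parameters, so invariance identifies it
   with the one chosen. *)
move=> D [/r3_representative_normal_form[a1' [a3' [c1' [c3' [_ DE DN]]]]] iso].
by rewrite DN; apply: r3_normal_form_invariant => //; rewrite -DE.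
Qed.
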